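(* Let $U\neq\emptyset$ be a set and let $F,G\colon U\to\mathbb{R}\cup\{+\infty\}$ be functions such that $F+G\not\equiv+\infty$. For $\alpha\in[0,+\infty)$ let $H_\alpha\colon U\to\mathbb{R}\cup\{+\infty\}$, $H_\alpha(u):=F(u)+\alpha G(u)$, and let $H_\alpha^\star:=\arg\min_{u\in U}H_\alpha(u)\subset U$. If there exist $a<b$ in $[0,+\infty)$ such that $H_\alpha^\star\neq\emptyset$ for every $\alpha\in[a,b]$, then for all but at most countably many $\alpha\in[a,b]$ we have $$\inf_{u\in H_\alpha^\star}G(u)=\sup_{u\in H_\alpha^\star}G(u).$$
   Context: $\arg\min_{u\in U}H_\alpha(u)$ is the (possibly empty) set of points of $U$ at which $H_\alpha$ attains its infimum over $U$. No structure on $U$ is assumed. Infima and suprema are taken in $[-\infty,+\infty]$. Convention: $0\cdot(+\infty)=0$, i.e. $H_0=F$. *)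

(* Defs.v *)
From mathcomp Require Import all_boot all_order all_algebra.
From mathcomp Require Import all_classical all_reals all_analysis.

Set Implicit Arguments.
Unset Strict Implicit.
Unset Printing Implicit Defensive.

Local Open Scope classical_set_scope.
Local Open Scope ring_scope.
Local Open Scope ereal_scope.

(* In [\bar R] one has 0 * +oo = 0, hence [penalized F G 0 = F]. *)
Definition penalized (R : realType) (U : Type) (F G : U -> \bar R) (alpha : R)
  : U -> \bar R := fun u => F u + alpha%:E * G u.

Definition argmin (R : realType) (U : Type) (H : U -> \bar R) : set U :=
  [set u | H u = ereal_inf (range H)].

(* Main.v *)
(* Larger weights penalize G more: if alpha < beta, adding the optimality
   inequalities of u for H_alpha and v for H_beta gives G v <= G u.  So when G
   takes values x < y on argmin H_alpha, the open intervals ]x, y[ obtained for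
   different alpha are disjoint, and each of them contains a rational. *)
Require Import Defs.
From mathcomp Require Import all_boot all_order all_algebra.
From mathcomp Require Import all_classical all_reals all_analysis.
From mathcomp Require Import lra.

Set Implicit Arguments.
Unset Strict Implicit.
Unset Printing Implicit Defensive.

Import Order.TTheory GRing.Theory Num.Theory.

Local Open Scope classical_set_scope.
Local Open Scope ring_scope.
Local Open Scope ereal_scope.

Lemma exists_rat_between (R : realType) (x y : \bar R) : x < y ->
  exists q : rat, x < (ratr q)%:E < y.
Proof.
(* It suffices to find real [r < s] inside the interval, which disposes of infinite endpoints. *)
suff aux (r s : R) : (r < s)%R -> x <= r%:E -> s%:E <= y ->
    exists q : rat, x < (ratr q)%:E < y.
  case: x y aux => [r| |] [s| |] aux // xy.
  - exact: (aux r s).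
  - by apply: (aux r (r + 1)%R); rewrite ?ltrDl ?ltr01 ?leey.
  - by apply: (aux (s - 1)%R s); rewrite ?ltrBlDr ?ltrDl ?ltr01 ?leNye.
  - by apply: (aux 0%R 1%R); rewrite ?leNye ?leey.
move=> /rat_in_itvoo[q]; rewrite in_itv/= => /andP[rq qs] xr sy.
exists q; apply/andP; split.
- by apply: le_lt_trans xr _; rewrite lte_fin.
- by apply: lt_le_trans sy; rewrite lte_fin.
Qed.

Lemma countable_is_subset1 (T : Type) (A : set T) : is_subset1 A -> countable A.
Proof.
move=> A1; apply/countable_injP; exists (fun=> 0%N) => x y.
by rewrite !inE => Ax Ay _; exact: A1.
Qed.

Section penalized.
Variables (R : realType) (U : Type) (F G : U -> \bar R).
Hypotheses (F_ninfty : forall u, F u <> -oo) (G_ninfty : forall u, G u <> -oo).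
Hypothesis FG_proper : ~ (forall u, F u + G u = +oo).

Lemma argmin_le (H : U -> \bar R) u v : argmin H u -> H u <= H v.
Proof. by move=> ->; apply: ereal_inf_lbound; exists v. Qed.

(** Properness yields a point [w] where [F] and [G] are both finite; it bounds the minimum for every
    weight at once. *)
Lemma argmin_penalized_lty (alpha : R) u :
  argmin (penalized F G alpha) u -> penalized F G alpha u < +oo.
Proof.
move=> Hu; have /existsNP[w FGw] := FG_proper.
apply: le_lt_trans (argmin_le w Hu) _; rewrite /penalized.
move: FGw (@F_ninfty w) (@G_ninfty w).
by case: (F w) (G w) => [r| |] [s| |]//=; rewrite -?EFinM -?EFinD ?ltry.
Qed.

Lemma argmin_penalized_fin_numl (alpha : R) u : (0 <= alpha)%R ->
  argmin (penalized F G alpha) u -> F u \is a fin_num.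
Proof.
move=> alpha0 /argmin_penalized_lty; rewrite /penalized fin_numE.
have [/F_ninfty//|_] := eqVneq (F u) -oo.
have [->|//] := eqVneq (F u) +oo; rewrite addye ?ltxx//.
move: (@G_ninfty u); case: (G u) => [//|_|//].
(* With [G u = +oo] the penalty is 0 or [+oo] according to whether [alpha] vanishes, so it never
   cancels [F u = +oo]. *)
by move: alpha0; rewrite le_eqVlt => /predU1P[<-|?]; rewrite ?mul0e ?gt0_muley.
Qed.

(** Strict positivity matters: a minimizer of [F] alone, the case of weight 0, may have
    [G u = +oo]. *)
Lemma argmin_penalized_fin_numr (alpha : R) u : (0 < alpha)%R ->
  argmin (penalized F G alpha) u -> G u \is a fin_num.
Proof.
move=> alpha0 /argmin_penalized_lty; rewrite /penalized fin_numE.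
have [/G_ninfty//|_] := eqVneq (G u) -oo.
have [->|//] := eqVneq (G u) +oo; rewrite gt0_muley ?lte_fin// addey ?ltxx//.
exact/eqP/F_ninfty.
Qed.

Lemma argmin_penalized_anti (alpha beta : R) u v : (0 <= alpha < beta)%R ->
  argmin (penalized F G alpha) u -> argmin (penalized F G beta) v -> G v <= G u.
Proof.
move=> /andP[alpha0 alphabeta] Hu Hv.
have beta0 : (0 < beta)%R := le_lt_trans alpha0 alphabeta.
(* Since [alpha] may be 0, [G u] can be infinite; all other values involved are finite. *)
have [->|Guy] := eqVneq (G u) +oo; first by rewrite leey.
have Gu : G u \is a fin_num by rewrite fin_numE Guy andbT; exact/eqP/G_ninfty.
have Gv := argmin_penalized_fin_numr beta0 Hv.
have Fu := argmin_penalized_fin_numl alpha0 Hu.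
have Fv := argmin_penalized_fin_numl (ltW beta0) Hv.
have := argmin_le u Hv; have := argmin_le v Hu; rewrite /penalized.
rewrite -(fineK Gu) -(fineK Gv) -(fineK Fu) -(fineK Fv).
rewrite -!EFinM -!EFinD !lee_fin => uv vu.
have gap0 : (0 < beta - alpha)%R by rewrite subr_gt0.
(* In the sum of [uv] and [vu] the values of [F] cancel, leaving [(beta - alpha) * G v <= (beta -
   alpha) * G u] on the real parts. *)
by rewrite -(ler_pM2l gap0); lra.
Qed.

End penalized.

Theorem theorem1p1 (R : realType) (U : Type) (U_neq0 : [set: U] !=set0)
    (F G : U -> \bar R)
    (F_ninfty : forall u, F u <> -oo) (G_ninfty : forall u, G u <> -oo)
    (FG_proper : ~ (forall u, F u + G u = +oo))
    (a b : R) (a_ge0 : (0 <= a)%R) (a_lt_b : (a < b)%R)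
    (argmin_neq0 : forall alpha : R, (a <= alpha <= b)%R ->
       argmin (penalized F G alpha) !=set0) :
  countable [set alpha : R | (a <= alpha <= b)%R /\
    ereal_inf (G @` argmin (penalized F G alpha)) <>
    ereal_sup (G @` argmin (penalized F G alpha))].
Proof.
pose rat_gap (q : rat) := [set alpha : R | (0 <= alpha)%R /\
  exists u v, [/\ argmin (penalized F G alpha) u,
    argmin (penalized F G alpha) v & G u < (ratr q)%:E < G v]].
have rat_gap1 q : is_subset1 (rat_gap q).
  suff nlt alpha beta : rat_gap q alpha -> rat_gap q beta -> ~ (alpha < beta)%R.
    by move=> alpha beta qa qb; case: (ltgtP alpha beta) => // /nlt; case.
  (* Take the low point [u] for [alpha] and the high point [v] for [beta]: monotonicity would give
     [q < G v <= G u < q]. *)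
  move=> [alpha0 [u [_ [Hu _ /andP[uq _]]]]] [_ [_ [v [_ Hv /andP[_ qv]]]]] ab.
  have /(argmin_penalized_anti F_ninfty G_ninfty FG_proper) vu :
    (0 <= alpha < beta)%R by rewrite alpha0.
  by have := lt_trans (lt_le_trans qv (vu _ _ Hu Hv)) uq; rewrite ltxx.
apply: (@sub_countable _ _ _ (\bigcup_q rat_gap q)); last first.
  by apply: bigcup_countable => // q _; exact: countable_is_subset1.
apply: subset_card_le => alpha [/[dup] alphaab /andP[aalpha _] infsup].
apply: contrapT => nogap; apply: infsup.
have nlt u v : argmin (penalized F G alpha) u ->
    argmin (penalized F G alpha) v -> ~ G u < G v.
  move=> Hu Hv /exists_rat_between[q uqv]; apply: nogap.
  by exists q => //; split; [exact: le_trans aalpha|exists u, v].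
(* Without a gap [G] is constant on the argmin. A point in it is still needed, as the empty set has
   infimum [+oo] and supremum [-oo]. *)
have [u Hu] := argmin_neq0 _ alphaab.
suff -> : G @` argmin (penalized F G alpha) = [set G u].
  by rewrite ereal_inf1 ereal_sup1.
apply/seteqP; split => [_ [v Hv <-]|_ ->]; last by exists u.
by case: (ltgtP (G v) (G u)) => // /nlt; case.
Qed.
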